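(* Let $k$ be an algebraically closed field and let $Q$ be a finite connected quiver without edge loops (i.e. there is no arrow $a$ with $s(a)=t(a)$). Let $\rho,\rho'\in\mathrm{Rep}_k(Q)$ be exceptional representations, and let $A,A'\subset V(Q)$ be the supports of the dimension vectors of $\rho$ and $\rho'$ respectively. If $A$ or $A'$ is a single element set, then the linear map $F_{\rho,\rho'}$ has maximal rank.
   Context: $V(Q)$, $Arr(Q)$ are the vertices and arrows of $Q$; $s(a),t(a)$ are the origin and end of an arrow $a$. $\mathrm{Rep}_k(Q)$ is the category of finite-dimensional $k$-representations of $Q$. A representation $\rho$ is exceptional if $\mathrm{Hom}(\rho,\rho)=k$ and $\mathrm{Ext}^1(\rho,\rho)=0$. The support of $\alpha\in\mathbb N^{V(Q)}$ is $\{i: \alpha_i\neq 0\}$. For representations $\rho,\rho'$ with dimension vectors $\alpha,\alpha'$, given by linear maps $\rho_a:k^{\alpha_{s(a)}}\to k^{\alpha_{t(a)}}$, $\rho'_a:k^{\alpha'_{s(a)}}\to k^{\alpha'_{t(a)}}$, the map $F_{\rho,\rho'}$ is $$F_{\rho,\rho'}:\prod_{i\in V(Q)}\mathrm{Hom}(k^{\alpha_i},k^{\alpha'_i})\to\prod_{a\in Arr(Q)}\mathrm{Hom}(k^{\alpha_{s(a)}},k^{\alpha'_{t(a)}}),\qquad \{f_i\}_{i}\mapsto\{f_{t(a)}\circ\rho_a-\rho'_a\circ f_{s(a)}\}_{a}.$$ A linear map has maximal rank if it is injective or surjective. *)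

(* Defs.v *)
From HB Require Import structures.
From mathcomp Require Import all_boot all_order all_algebra.

Set Implicit Arguments.
Unset Strict Implicit.
Unset Printing Implicit Defensive.

Import GRing.Theory.
Local Open Scope ring_scope.

Record quiver := Quiver {
  vert : finType;
  arr : finType;
  src : arr -> vert;
  tgt : arr -> vert
}.

Definition loopless (Q : quiver) : Prop := forall a : arr Q, src a != tgt a.

Definition adjacent (Q : quiver) : rel (vert Q) := fun x y =>
  [exists a : arr Q, ((src a == x) && (tgt a == y)) ||
                     ((src a == y) && (tgt a == x))].

Definition connected (Q : quiver) : Prop :=
  (0 < #|vert Q|)%N /\ forall x y : vert Q, connect (@adjacent Q) x y.

(* Linear maps k^n -> k^m are m x n matrices acting on column vectors, so that *)
(* composition is *m read from right to left. The finite-dimensional           *)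
(* representations are taken with vertex spaces k^(dimv i).                    *)
Record rep (k : fieldType) (Q : quiver) := Rep {
  dimv : vert Q -> nat;
  rmap : forall a : arr Q, 'M[k]_(dimv (tgt a), dimv (src a))
}.

Section Representations.
Variables (k : fieldType) (Q : quiver).
Implicit Types M N R : rep k Q.

Definition dim_support R : {set vert Q} := [set i | dimv R i != 0%N].

Definition vmaps M N := {dffun forall i : vert Q, 'M[k]_(dimv N i, dimv M i)}.

Definition amaps M N :=
  {dffun forall a : arr Q, 'M[k]_(dimv N (tgt a), dimv M (src a))}.

Definition Fmap M N (f : vmaps M N) : amaps M N :=
  [ffun a : arr Q => (f (tgt a) *m rmap M a - rmap N a *m f (src a))
                     : 'M[k]_(dimv N (tgt a), dimv M (src a))].

Definition is_hom M N (f : vmaps M N) : Prop :=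
  forall a : arr Q, f (tgt a) *m rmap M a = rmap N a *m f (src a).

(* Hom(R, R) = k : c |-> c id is a bijection from k onto the endomorphisms.    *)
(* Uniqueness of c excludes the zero representation.                           *)
Definition End_is_k R : Prop :=
  forall f : vmaps R R, is_hom f ->
    exists! c : k, forall i : vert Q, f i = c%:M.

Definition short_exact N E M (i : vmaps N E) (p : vmaps E M) : Prop :=
  forall v : vert Q,
    [/\ injective (fun x : 'cV[k]_(dimv N v) => i v *m x),
        forall y : 'cV[k]_(dimv E v),
          p v *m y = 0 <-> exists x : 'cV[k]_(dimv N v), i v *m x = y
      & forall z : 'cV[k]_(dimv M v),
          exists y : 'cV[k]_(dimv E v), p v *m y = z].

(* An extension 0 -> N -> E -> M -> 0 of M by N in Rep_k(Q).                   *)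
Record extension M N := Extension {
  ext_mid : rep k Q;
  ext_i : vmaps N ext_mid;
  ext_p : vmaps ext_mid M;
  ext_i_hom : is_hom ext_i;
  ext_p_hom : is_hom ext_p;
  ext_exact : short_exact ext_i ext_p
}.

(* Yoneda equivalence; such a phi is an isomorphism by the five lemma.         *)
Definition ext_equiv M N (e e' : extension M N) : Prop :=
  exists phi : vmaps (ext_mid e) (ext_mid e'),
    [/\ is_hom phi,
        forall v : vert Q, phi v *m ext_i e v = ext_i e' v
      & forall v : vert Q, ext_p e' v *m phi v = ext_p e v].

Definition dsum N M : rep k Q :=
  @Rep k Q (fun i => dimv N i + dimv M i)%N
    (fun a => block_mx (rmap N a) 0 0 (rmap M a)).

Definition dsum_in N M : vmaps N (dsum N M) :=
  [ffun v : vert Q => (col_mx 1%:M 0 : 'M[k]_(dimv N v + dimv M v, dimv N v))].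

Definition dsum_out N M : vmaps (dsum N M) M :=
  [ffun v : vert Q => (row_mx 0 1%:M : 'M[k]_(dimv M v, dimv N v + dimv M v))].

Lemma dsum_in_hom N M : is_hom (dsum_in N M).
Proof.
by move=> a; rewrite !ffunE mul_block_col mul_col_mx !mulmx0 !mul0mx mul1mx
  mulmx1 !addr0.
Qed.

Lemma dsum_out_hom N M : is_hom (dsum_out N M).
Proof.
by move=> a; rewrite !ffunE mul_row_block mul_mx_row !mulmx0 !mul0mx mul1mx
  mulmx1 !add0r.
Qed.

Lemma dsum_exact N M : short_exact (dsum_in N M) (dsum_out N M).
Proof.
move=> v; rewrite !ffunE; split.
- by move=> x y /=; rewrite !mul_col_mx !mul1mx => /eq_col_mx[].
- move=> y; rewrite -[y](@vsubmxK _ (dimv N v) (dimv M v)) mul_row_col mul0mx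
    mul1mx add0r; split=> [->|[x]].
    by exists (usubmx y); rewrite mul_col_mx mul1mx mul0mx.
  by rewrite mul_col_mx mul0mx => /eq_col_mx[].
- by move=> z; exists (col_mx 0 z); rewrite mul_row_col mulmx0 mul1mx add0r.
Qed.

Definition split_extension M N : extension M N :=
  Extension (@dsum_in_hom N M) (@dsum_out_hom N M) (@dsum_exact N M).

(* Ext^1(M, N) = 0, with Ext^1 the group of Yoneda classes of extensions,      *)
(* whose zero element is the class of the split extension.                     *)
Definition Ext1_zero M N : Prop :=
  forall e : extension M N, ext_equiv e (split_extension M N).

Definition exceptional R : Prop := End_is_k R /\ Ext1_zero R R.

End Representations.

Definition maximal_rank (T U : Type) (f : T -> U) : Prop :=
  injective f \/ (forall y : U, exists x : T, f x = y).

(* Main.v *)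
Require Import Defs.
From Stdlib Require Import Classical_Prop.
From mathcomp Require Import all_boot all_order all_algebra.

(** The kernel of [Fmap] between [M] and [N] is Hom(M, N) and its cokernel is
    Ext^1(M, N), so the theorem says that one of these two spaces vanishes.

    A representation whose support is a single vertex and whose endomorphisms
    are scalars is one-dimensional, because in the absence of loops all its
    arrow maps are zero; call it S.  A nonzero map from S to N is then
    injective and a nonzero map from M to S is surjective.  Path algebras are
    hereditary: Ext^1 is right exact in each variable.  Hence an embedding of S
    into N makes Ext^1(N, N) -> Ext^1(S, N) surjective, and Ext^1(N, N) = 0
    because N is exceptional; dually for a surjection from M onto S.  So if
    [Fmap] is not injective, it is surjective.

    In terms of matrices, the vanishing of Ext^1(M, N) is turned into the
    surjectivity of [Fmap] by [Ext1_zero_Fmap_surj], and right exactness is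
    [Fmap_surj_sub] and [Fmap_surj_quo]. *)

Set Implicit Arguments.
Unset Strict Implicit.
Unset Printing Implicit Defensive.

Import GRing.Theory.
Local Open Scope ring_scope.

Section Proof.
Variables (k : fieldType) (Q : quiver).
Implicit Types M N S : rep k Q.

(* [dimv] alone now denotes the dimension of a subspace of a vector space. *)
Local Notation dimv := Defs.dimv.

(** The case distinction is classical; two distinct families with the same
    image are then ruled out because their difference is a nonzero
    homomorphism. *)
Lemma maximal_rank_Fmap M N :
    (forall d : vmaps M N, is_hom d -> (exists v, d v != 0) ->
      forall g : amaps M N, exists f, Fmap f = g) ->
  maximal_rank (@Fmap k Q M N).
Proof.
move=> surjF.
have [[d [d_hom d_neq0]] | no_hom] :=
    classic (exists d : vmaps M N, is_hom d /\ exists v, d v != 0).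
  by right; apply: surjF d_hom d_neq0.
left=> f g /ffunP eq_fg; apply/ffunP=> v; apply/eqP/negPn/negP=> neq_v.
apply: no_hom; exists [ffun v => f v - g v]; split; last first.
  by exists v; rewrite ffunE subr_eq0.
move=> a; have := eq_fg a; rewrite !ffunE mulmxBl mulmxBr.
move=> /(canRL (subrK _)) ->.
by rewrite addrC !addrA addNr add0r addrC.
Qed.

(** A family of matrices indexed by the arrows is a cocycle: it glues [M] on
    top of [N]. *)
Definition twist M N (g : amaps M N) : rep k Q :=
  @Rep k Q (fun i => dimv N i + dimv M i)%N
    (fun a => block_mx (rmap N a) (g a) 0 (rmap M a)).

Definition twist_in M N (g : amaps M N) : vmaps N (twist g) := dsum_in N M.

Definition twist_out M N (g : amaps M N) : vmaps (twist g) M := dsum_out N M.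

Lemma twist_in_hom M N (g : amaps M N) : is_hom (twist_in g).
Proof.
by move=> a; rewrite !ffunE mul_block_col mul_col_mx !mulmx0 !mul0mx mul1mx
  mulmx1 !addr0.
Qed.

Lemma twist_out_hom M N (g : amaps M N) : is_hom (twist_out g).
Proof.
by move=> a; rewrite !ffunE mul_row_block mul_mx_row !mulmx0 !mul0mx mul1mx
  mulmx1 !add0r.
Qed.

Definition twist_extension M N (g : amaps M N) : extension M N :=
  @Extension k Q M N (twist g) (twist_in g) (twist_out g)
    (@twist_in_hom M N g) (@twist_out_hom M N g) (@dsum_exact k Q N M).

(** An equivalence of the extension twisted by [g] with the split one is
    unipotent upper triangular at each vertex; commutation with the arrows
    says that its corner block is a preimage of [g], up to sign. *)
Lemma Ext1_zero_Fmap_surj M N :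
  Ext1_zero M N -> forall g : amaps M N, exists f, Fmap f = g.
Proof.
move=> ext0 g; have [phi [phi_hom phi_in phi_out]] := ext0 (twist_extension g).
pose h v : 'M_(dimv N v, dimv M v) :=
  @ursubmx _ (dimv N v) (dimv M v) (dimv N v) (dimv M v) (phi v).
have phiE v : phi v = block_mx 1%:M (h v) 0 1%:M :> 'M_(dimv N v + dimv M v).
  have := phi_in v; have := phi_out v; rewrite /= !ffunE.
  rewrite -[phi v](@submxK _ (dimv N v) (dimv M v) (dimv N v) (dimv M v)).
  rewrite mul_row_block mul_block_col !mul0mx !mulmx0 !mul1mx !mulmx1.
  by rewrite !addr0 !add0r => /eq_row_mx[-> ->] /eq_col_mx[-> _].
exists [ffun v => - h v]; apply/ffunP=> a; rewrite !ffunE.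
have := phi_hom a; rewrite !phiE /= !mulmx_block.
rewrite !mul0mx !mulmx0 !mul1mx !mulmx1 !addr0 => /eq_block_mx[_ e _ _].
by rewrite mulNmx mulmxN opprK -e addrC addrK.
Qed.

(** A vertexwise retraction [r] of [j] extends every family of maps out of [S]
    to a family of maps out of [M], and a preimage of the extension restricts
    along [j] because [j] commutes with the arrows. *)
Lemma Fmap_surj_sub S M N (j : vmaps S M) :
    is_hom j -> (forall v, row_full (j v)) ->
    (forall g : amaps M N, exists f, Fmap f = g) ->
  forall g : amaps S N, exists f, Fmap f = g.
Proof.
move=> j_hom j_full surjF g; pose r v := pinvmx (j v).
have [f /ffunP fE] := surjF [ffun a => g a *m r (src a)].
exists [ffun v => f v *m j v]; apply/ffunP=> a; have := fE a; rewrite !ffunE.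
move=> e; rewrite -mulmxA j_hom !mulmxA -mulmxBl e.
by rewrite -mulmxA mulVpmx // mulmx1.
Qed.

(** Dually, vertexwise sections of [p] lift families of maps into [S] to
    families of maps into [N]. *)
Lemma Fmap_surj_quo S M N (p : vmaps N S) :
    is_hom p -> (forall v, row_free (p v)) ->
    (forall g : amaps M N, exists f, Fmap f = g) ->
  forall g : amaps M S, exists f, Fmap f = g.
Proof.
move=> p_hom p_free surjF g; pose s v := pinvmx (p v).
have [f /ffunP fE] := surjF [ffun a => s (tgt a) *m g a].
exists [ffun v => p v *m f v]; apply/ffunP=> a; have := fE a; rewrite !ffunE.
move=> e; rewrite mulmxA -p_hom -!mulmxA -mulmxBr e.
by rewrite mulmxA mulmxVp // mul1mx.
Qed.

(** Every family of matrices is an endomorphism, since each arrow has an end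
    outside the support; so all square matrices at the vertex are scalar. *)
Lemma dimv_single_support S :
    loopless Q -> End_is_k S -> #|dim_support S| = 1%N ->
  exists i, forall v, dimv S v = (v == i).
Proof.
move=> noloop endS /eqP/cards1P[i suppS]; exists i.
have dimE v : (dimv S v != 0%N) = (v == i).
  by have /setP/(_ v) := suppS; rewrite !inE.
have dim0 v : v != i -> dimv S v = 0%N.
  by rewrite -dimE negbK => /eqP.
move=> v; have [-> {v} | /dim0 //] := eqVneq v i.
pose f : vmaps S S := [ffun v => pid_mx 1].
have f_hom : is_hom f.
  move=> a; apply/matrixP=> x y; have [s_i | /dim0 s0] := eqVneq (src a) i.
    have /dim0 t0 : tgt a != i by rewrite -s_i eq_sym noloop.
    by have := ltn_ord x; rewrite [X in (_ < X)%N]t0.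
  by have := ltn_ord y; rewrite [X in (_ < X)%N]s0.
have [c [/(_ i) fiE _]] := endS f f_hom; move: fiE; rewrite ffunE.
have := dimE i; rewrite eqxx; case: (dimv S i) => [|[|n]] // _ /matrixP fiE.
(* the top left coefficient gives c = 1, the bottom right one c = 0 *)
have := fiE ord0 ord0; have := fiE ord_max ord_max; rewrite !mxE !eqxx /=.
by move=> <- /eqP; rewrite oner_eq0.
Qed.

(** The source is a line at [i] and zero elsewhere, so that a matrix with this
    source is injective as soon as it is nonzero. *)
Lemma vmaps_from_single_full S M i (d : vmaps S M) :
    (forall v, dimv S v = (v == i)) -> (exists v, d v != 0) ->
  forall v, row_full (d v).
Proof.
move=> dimS [w]; rewrite -mxrank_eq0 -lt0n => rk_w v.
rewrite /row_full eqn_leq rank_leq_col [X in (X <= _)%N]dimS.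
have := leq_trans rk_w (rank_leq_col _).
rewrite [X in (_ < X)%N]dimS lt0b => /eqP w_i.
by have [->|//] := eqVneq v i; rewrite -w_i.
Qed.

Lemma vmaps_to_single_free S M i (d : vmaps M S) :
    (forall v, dimv S v = (v == i)) -> (exists v, d v != 0) ->
  forall v, row_free (d v).
Proof.
move=> dimS [w]; rewrite -mxrank_eq0 -lt0n => rk_w v.
rewrite /row_free eqn_leq rank_leq_row [X in (X <= _)%N]dimS.
have := leq_trans rk_w (rank_leq_row _).
rewrite [X in (_ < X)%N]dimS lt0b => /eqP w_i.
by have [->|//] := eqVneq v i; rewrite -w_i.
Qed.

End Proof.

Theorem lemma4p5 (k : closedFieldType) (Q : quiver)
    (hconn : connected Q) (hloop : loopless Q)
    (rho rho' : rep k Q)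
    (hrho : exceptional rho) (hrho' : exceptional rho')
    (hsupp : #|dim_support rho| = 1%N \/ #|dim_support rho'| = 1%N) :
  maximal_rank (@Fmap k Q rho rho').
Proof.
have [[end_rho ext_rho] [end_rho' ext_rho']] := (hrho, hrho').
apply: maximal_rank_Fmap => d d_hom d_neq0; case: hsupp => supp1.
  have [i dimE] := dimv_single_support hloop end_rho supp1.
  apply: (Fmap_surj_sub d_hom (vmaps_from_single_full dimE d_neq0)).
  exact: Ext1_zero_Fmap_surj ext_rho'.
have [i dimE] := dimv_single_support hloop end_rho' supp1.
apply: (Fmap_surj_quo d_hom (vmaps_to_single_free dimE d_neq0)).
exact: Ext1_zero_Fmap_surj ext_rho.
Qed.
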